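(* There is no minimally nonideal clutter matrix whose core is the point-line incidence matrix of the projective plane $\mathrm{PG}(2,3)$.
   Context: A clutter $\mathcal{C}=(V,E)$ is a finite set $V$ with a family $E$ of subsets of $V$ (hyperedges) none containing another; its clutter matrix has a row for each hyperedge (its incidence vector) and a column for each vertex. $\mathcal{C}$ (or its matrix $A$, of size $m\times n$) is ideal if the polyhedron $\{x\in\mathbb{R}^n: Ax\ge\mathbf{1},\ x\ge\mathbf{0}\}$ has only integral vertices. Deletion $\mathcal{C}\backslash v$: vertex set $V\setminus\{v\}$, hyperedges those of $\mathcal{C}$ not containing $v$. Contraction $\mathcal{C}/v$: vertex set $V\setminus\{v\}$, hyperedges the inclusion-minimal sets $H\setminus\{v\}$, $H\in E$. Minors are obtained by sequences of deletions and contractions. $\mathcal{C}$ is minimally nonideal if it is not ideal but every proper minor is ideal. The core of $A$ is the submatrix formed by its rows of minimum weight (number of ones); ''the core is the point-line incidence matrix of a projective plane'' means the vertices are the points and the minimum-cardinality hyperedges are exactly the lines. *)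

(* Defs.v *)
From mathcomp Require Import all_boot all_order all_algebra.
From mathcomp Require Import reals.

Set Implicit Arguments.
Unset Strict Implicit.
Unset Printing Implicit Defensive.

Import Order.TTheory GRing.Theory Num.Theory.
Local Open Scope ring_scope.

(* The vertex set is a subset of an ambient finite type, so that a clutter and
   all its minors live in the same type. *)
Definition is_clutter (T : finType) (V : {set T}) (E : {set {set T}}) : bool :=
  [forall e in E, e \subset V] &&
  [forall e in E, forall f in E, (e \subset f) ==> (e == f)].

Record clutter (T : finType) := Clutter {
  vertices : {set T};
  hyperedges : {set {set T}};
  clutterP : is_clutter vertices hyperedges }.

Section Minors.
Variable T : finType.
Implicit Types (C D : clutter T) (v : T) (F : {set {set T}}).

Definition inclusion_minimal F : {set {set T}} :=
  [set e in F | [forall f in F, (f \subset e) ==> (f == e)]].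

Definition del_edges C v : {set {set T}} :=
  [set e in hyperedges C | v \notin e].

Definition contr_edges C v : {set {set T}} :=
  inclusion_minimal [set e :\ v | e in hyperedges C].

Lemma del_is_clutter C v : is_clutter (vertices C :\ v) (del_edges C v).
Proof.
have /andP[/forall_inP sEV /forall_inP anti] := clutterP C.
apply/andP; split; apply/forall_inP => e; rewrite inE /= => /andP[eE vNe].
  by rewrite subsetD1 sEV.
apply/forall_inP => f; rewrite inE /= => /andP[fE _].
by move/forall_inP: (anti e eE); apply.
Qed.

Lemma contr_is_clutter C v : is_clutter (vertices C :\ v) (contr_edges C v).
Proof.
have /andP[/forall_inP sEV _] := clutterP C.
apply/andP; split; apply/forall_inP => e; rewrite inE => /andP[eE _].
  by case/imsetP: eE => f fE ->; apply/setSD/sEV.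
by apply/forall_inP => f; rewrite inE => /andP[_ /forall_inP]; apply.
Qed.

Definition deletion C v : clutter T := Clutter (del_is_clutter C v).
Definition contraction C v : clutter T := Clutter (contr_is_clutter C v).

Inductive minor C : clutter T -> Prop :=
| minor_refl : minor C C
| minor_del D v : minor C D -> v \in vertices D -> minor C (deletion D v)
| minor_contr D v : minor C D -> v \in vertices D -> minor C (contraction D v).

Definition core C : {set {set T}} :=
  [set e in hyperedges C | [forall f in hyperedges C, (#|e| <= #|f|)%N]].

End Minors.

Definition clutter_matrix (R : realType) (T : finType) (C : clutter T) :
    'M[R]_(#|hyperedges C|, #|vertices C|) :=
  \matrix_(i, j) (enum_val j \in (enum_val i : {set T}))%:R.

Definition covering_polyhedron (R : realType) (m n : nat) (A : 'M[R]_(m, n))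
    (x : 'cV[R]_n) : Prop :=
  (forall i, 1 <= (A *m x) i 0) /\ (forall j, 0 <= x j 0).

Definition extreme_point (R : realType) (n : nat) (P : 'cV[R]_n -> Prop)
    (x : 'cV[R]_n) : Prop :=
  P x /\ forall (y z : 'cV[R]_n) (t : R), P y -> P z -> 0 < t -> t < 1 ->
    x = t *: y + (1 - t) *: z -> y = x /\ z = x.

Definition ideal_matrix (R : realType) (m n : nat) (A : 'M[R]_(m, n)) : Prop :=
  forall x, extreme_point (covering_polyhedron A) x ->
    forall j, x j 0 \is a Num.int.

Definition ideal (R : realType) (T : finType) (C : clutter T) : Prop :=
  ideal_matrix (clutter_matrix R C).

Definition minimally_nonideal (R : realType) (T : finType) (C : clutter T) :
    Prop :=
  ~ ideal R C /\ forall D, minor C D -> D <> C -> ideal R D.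

(* Subspaces of F^3 are encoded by their canonical generating matrices, i.e.
   the fixpoints of A |-> <<A>>%MS: one matrix per row space. *)
Definition pg_points (F : finFieldType) : {set 'M[F]_3} :=
  [set P : 'M[F]_3 | (<<P>>%MS == P) && (\rank P == 1%N)].

(* Each 2-dimensional subspace is given as the set of points it contains. *)
Definition pg_lines (F : finFieldType) : {set {set 'M[F]_3}} :=
  [set [set P in pg_points F | (P <= L)%MS]
     | L : 'M[F]_3 in [pred L : 'M[F]_3 | \rank L == 2%N]].

(* The incidence matrices agree up to a relabelling phi of the columns (and a
   reordering of the rows). *)
Definition core_is_PG2 (F : finFieldType) (T : finType) (C : clutter T) : Prop :=
  exists phi : T -> 'M[F]_3,
    [/\ {in vertices C &, injective phi},
        phi @: vertices C = pg_points F &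
        [set phi @: (e : {set T}) | e in core C] = pg_lines F].

(* Main.v *)
Require Import Defs.
From mathcomp Require Import all_boot all_order all_algebra.
From mathcomp Require Import boolp reals lra.

(** Write f(S) for "S contains a hyperedge". Ideality of the deletion of a point
forces every hyperedge to meet every line (the case at hand of Lehman's theorem),
so f is known except on the nontrivial blocking sets of PG(2,3), which have 6 or 7
points. A minor that is a degenerate projective plane, with hyperedges {c, i} for
i in S together with S itself, is nonideal; hence no set I of contracted points may
satisfy f(I + c + i) = 1, f(I + S) = 1, f(I + c) = 0 and f(I + S - i) = 0 for all i
in S. A case distinction on f at finitely many blocking sets always ends in such a
minor with |S| = 2, 3 or 4. *)

Set Implicit Arguments.
Unset Strict Implicit.
Unset Printing Implicit Defensive.

Import Order.TTheory GRing.Theory Num.Theory.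
Local Open Scope ring_scope.

(** * Extreme points of a polyhedron below a given weight *)

Section ExtremePoints.
Variables (R : realType) (n : nat).

Lemma extreme_point_iff (P Q : 'cV[R]_n -> Prop) x :
  (forall y, P y <-> Q y) -> extreme_point P x -> extreme_point Q x.
Proof.
move=> PQ [Px ext]; split; first exact/PQ.
by move=> y z t /PQ Py /PQ Pz; apply: ext.
Qed.

Variables (p : nat) (G : 'M[R]_(p, n)) (h : 'cV[R]_p) (w : 'rV[R]_n).
Let P (y : 'cV[R]_n) := forall k, h k 0 <= (G *m y) k 0.
Let tight (y : 'cV[R]_n) := [set k | (G *m y) k 0 == h k 0].

(** This rules out rays inside [P] along which [w] does not increase: following such a direction,
    one must hit a new constraint. *)
Hypothesis decreasing_exit :
  forall d : 'cV[R]_n, d != 0 -> (w *m d) 0 0 <= 0 -> exists k, (G *m d) k 0 < 0.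

(** A pivoting step: a point that is not extreme can move along a line that keeps its tight
    constraints tight, in the sense that does not increase [w], until a further constraint becomes
    tight. *)
Lemma more_tight x : P x -> ~ extreme_point P x ->
  exists y, [/\ P y, (w *m y) 0 0 <= (w *m x) 0 0 & (#|tight x| < #|tight y|)%N].
Proof.
move=> Px next.
have [d [d0 wd dtight]] : exists d : 'cV[R]_n, [/\ d != 0, (w *m d) 0 0 <= 0 &
    forall k, k \in tight x -> (G *m d) k 0 = 0].
  have [d [d0 dtight]] : exists d : 'cV[R]_n, d != 0 /\
      forall k, k \in tight x -> (G *m d) k 0 = 0.
    apply: contrapT => nod; apply: next; split=> // y z t Py Pz t0 t1 xE.
    have [yz|yz] := eqVneq y z.
      by have -> : x = y by rewrite xE -yz -scalerDl addrC subrK scale1r.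
    case: nod; exists (y - z); split; first by rewrite subr_eq0.
    move=> k; rewrite inE xE mulmxDr -!scalemxAr mulmxBr !mxE => /eqP.
    (* A constraint tight at a proper convex combination of [y] and [z] is tight at both, so [y - z]
       is a direction of the required kind. *)
    move: (Py k) (Pz k); rewrite !mxE; set a := \sum_j _; set b := \sum_j _ => *.
    by nra.
  have [wd|/ltW wd] := lerP ((w *m d) 0 0) 0; first by exists d.
  exists (- d); split=> [||k /dtight dk]; first by rewrite oppr_eq0.
    by rewrite mulmxN [leLHS]mxE oppr_le0.
  by rewrite mulmxN [LHS]mxE dk oppr0.
have [k0 k0d] := decreasing_exit d0 wd.
(* [ratio k] is the step length at which constraint [k] becomes tight; the smallest one keeps the
   point in [P]. *)
pose ratio k := ((G *m x) k 0 - h k 0) / - (G *m d) k 0.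
case: (arg_minP (P := fun k => (G *m d) k 0 < 0) ratio k0d) => k kd kmin.
have rk0 : 0 <= ratio k.
  by rewrite divr_ge0 ?subr_ge0 ?Px // oppr_ge0 ltW.
have Gy i : (G *m (x + ratio k *: d)) i 0 = (G *m x) i 0 + ratio k * (G *m d) i 0.
  by rewrite mulmxDr -scalemxAr [LHS]mxE [X in _ + X]mxE.
exists (x + ratio k *: d); split.
- move=> i; rewrite Gy; have [di|di] := ltrP ((G *m d) i 0) 0.
    have := kmin i di; rewrite /ratio ler_pdivlMr ?oppr_gt0 //.
    by move=> /= H; move: H; rewrite -/(ratio k); lra.
  by rewrite (le_trans (Px i)) // lerDl mulr_ge0.
- by rewrite mulmxDr -scalemxAr [leLHS]mxE [X in _ + X]mxE gerDl mulr_ge0_le0.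
- apply/proper_card/properP; split.
    apply/subsetP => i it; move: (it); rewrite !inE Gy => /eqP ->.
    by rewrite dtight // mulr0 addr0.
  exists k; last by apply/negP => /dtight kd0; rewrite kd0 ltxx in kd.
  have e : ratio k * (G *m d) k 0 = h k 0 - (G *m x) k 0.
    by rewrite /ratio invrN mulrN mulNr divfK ?lt_eqF // opprB.
  by rewrite inE Gy e addrC subrK.
Qed.

Lemma extreme_point_below x : P x ->
  exists2 y, extreme_point P y & (w *m y) 0 0 <= (w *m x) 0 0.
Proof.
have [m] := ubnP (p - #|tight x|); elim: m x => // m IH x ltm Px.
have [ext|/(more_tight Px)[y [Py wy lty]]] := EM (extreme_point P x).
  by exists x.
have [|z extz wz] := IH y _ Py; last by exists z => //; apply: le_trans wy.
have le_p : (#|tight y| <= p)%N by rewrite -[leqRHS]card_ord max_card.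
by rewrite (leq_trans _ (ltm : (_ <= m)%N)) // ltn_sub2l // (leq_trans lty).
Qed.

End ExtremePoints.
Arguments extreme_point_below {R n p} G h w.

(** * Transversals of ideal clutters *)

Section Ideal.
Variables (R : realType) (T : finType).
Implicit Types (C D : clutter T) (S B I K : {set T}) (x w : T -> R).

Lemma hyperedge_sub D e : e \in hyperedges D -> e \subset vertices D.
Proof. by have /andP[/forall_inP + _] := clutterP D; apply. Qed.

(** An extreme point [y] of no larger weight than [x] is integral, so its nonzero coordinates are at
    least 1 and its support is a transversal that weighs at most as much as [y]. *)
Lemma ideal_transversal D x w :
    ideal R D ->
    (forall v, v \in vertices D -> 0 <= x v) ->
    (forall e, e \in hyperedges D -> 1 <= \sum_(v in e) x v) ->
    (forall v, v \in vertices D -> 0 < w v) ->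
  exists B, [/\ B \subset vertices D,
    forall e, e \in hyperedges D -> ~~ [disjoint e & B] &
    \sum_(v in B) w v <= \sum_(v in vertices D) w v * x v].
Proof.
move=> idD x0 xe w0.
set n := #|vertices D|; pose A := clutter_matrix R D.
pose wr : 'rV[R]_n := \row_j w (enum_val j).
pose xc : 'cV[R]_n := \col_j x (enum_val j).
pose G := col_mx A 1%:M; pose h : 'cV[R]_(#|hyperedges D| + n) := col_mx (const_mx 1) 0.
have PE y : covering_polyhedron A y <-> forall k, h k 0 <= (G *m y) k 0.
  rewrite /G /h mul_col_mx mul1mx; split=> [[Ay y0] k|Gy].
    by case: (split_ordP k) => i ->; rewrite ?(col_mxEu, col_mxEd) mxE ?Ay ?y0.
  split=> i; first by have := Gy (lshift _ i); rewrite !col_mxEu mxE.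
  by have := Gy (rshift _ i); rewrite !col_mxEd mxE.
have [||y exty wy] := extreme_point_below G h wr _ xc.
(* The nonnegativity rows force [d >= 0], and then positive weights with nonpositive total force
   [d = 0]. *)
- move=> d d0 wd; apply: contrapT => /forallNP nod.
  have {}d0' j : 0 <= d j 0.
    have /negP := nod (rshift _ j); rewrite -leNgt.
    by rewrite /G mul_col_mx mul1mx col_mxEd.
  have wr0 j : 0 < wr 0 j by rewrite mxE w0 ?enum_valP.
  case/negP: d0; apply/eqP/colP => j; rewrite mxE.
  move: wd; rewrite mxE => wd.
  have /eqP: \sum_k wr 0 k * d k 0 = 0.
    by apply/eqP; rewrite eq_le wd sumr_ge0 // => k _; rewrite mulr_ge0 // ltW.
  rewrite psumr_eq0 => [|k _]; last by rewrite mulr_ge0 // ltW.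
  move=> /allP /(_ j); rewrite mem_index_enum => /(_ isT) /=.
  by rewrite mulf_eq0 gt_eqF //= => /eqP.
- apply/PE; split=> i; last by rewrite mxE x0 ?enum_valP.
  have eE := enum_valP i.
  have -> : (A *m xc) i 0 =
      \sum_(v in vertices D) (v \in (enum_val i : {set T}))%:R * x v.
    rewrite mxE (big_enum_val (fun v => (v \in (enum_val i : {set T}))%:R * x v)).
    by apply: eq_bigr => j _; rewrite !mxE.
  apply: le_trans (xe _ eE) _.
  rewrite big_mkcond [leRHS]big_mkcond /=; apply: ler_sum => v _.
  have [ve|vNe] := boolP (v \in _); last by case: ifP; rewrite ?mul0r.
  by rewrite (subsetP (hyperedge_sub eE)) ?mul1r.
have {}exty : extreme_point (covering_polyhedron A) y.
  by apply: extreme_point_iff exty => z; apply: iff_sym; apply: PE.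
have yint := idD _ exty; have [[Ay y0] _] := exty.
pose supp := [set j | y j 0 != 0].
exists [set enum_val j | j in supp]; split.
- by apply/subsetP => _ /imsetP[j _ ->]; apply: enum_valP.
- move=> e eE; apply/negP => dis.
  have := Ay (enum_rank_in eE e); rewrite mxE big1 ?ler10 // => j _.
  rewrite /A [X in X * _]mxE enum_rankK_in //; case: (boolP (enum_val j \in e)); rewrite ?mul0r //.
  move=> je; have [->|yj] := eqVneq (y j 0) 0; first by rewrite mulr0.
  by move/disjointFr: dis => /(_ _ je) /negP[]; apply: imset_f; rewrite inE.
- rewrite big_imset /=; last by move=> i j _ _; apply: enum_val_inj.
  have -> : \sum_(v in vertices D) w v * x v = (wr *m xc) 0 0.
    rewrite mxE (big_enum_val (fun v => w v * x v)) /=.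
    by apply: eq_bigr => j _; rewrite /wr /xc !mxE.
  apply: le_trans wy; rewrite mxE big_mkcond /=; apply: ler_sum => j _.
  have wj : 0 < w (enum_val j) by apply/w0/enum_valP.
  rewrite /wr mxE inE; case: eqVneq => [->|yj] /=; first by rewrite mulr0.
  rewrite ler_peMr ?(ltW wj) //.
  have /intrP[z zE] := yint j; move: (y0 j) yj; rewrite zE.
  by rewrite ler0z intr_eq0 -[1]/(1%:~R) ler_int => z0 z1; rewrite -gtz0_ge1 lt_def z1.
Qed.

(** * Minors and the monotone function of a clutter *)

Definition spans D S := [exists e in hyperedges D, e \subset S].

Lemma spansS D S S' : S \subset S' -> spans D S -> spans D S'.
Proof.
move=> sSS' /exists_inP[e eE eS]; apply/exists_inP; exists e => //.
exact: subset_trans sSS'.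
Qed.

(** In terms of the monotone Boolean function [spans D], deletion fixes the variable [v] to 0 and
    contraction fixes it to 1. *)
Lemma spans_deletion D v S : spans (deletion D v) S = spans D (S :\ v).
Proof.
apply/exists_inP/exists_inP => -[e]; rewrite ?inE.
  by case/andP=> eE vNe eS; exists e; rewrite // subsetD1 eS.
by move=> eE; rewrite subsetD1 => /andP[eS vNe]; exists e; rewrite // inE eE.
Qed.

Lemma spans_contraction D v S : spans (contraction D v) S = spans D (v |: S).
Proof.
apply/exists_inP/exists_inP => -[e].
  rewrite inE => /andP[/imsetP[f fE ->] _]; rewrite subDset => fS.
  by exists f.
move=> eE eS.
pose F := [set f :\ v | f in hyperedges D].
have Fe : e :\ v \in F by apply: imset_f.
(* The set [e :\ v] need not be minimal, so a minimal member of the family below it serves as the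
   hyperedge of the contraction. *)
have [f /minsetP[fF fmin] fe] := minset_exists Fe.
exists f; last by rewrite (subset_trans fe) // subDset.
rewrite inE; apply/andP; split; first exact: fF.
apply/forall_inP => g gF; apply/implyP => gf.
by rewrite (fmin g).
Qed.

Lemma deletions_minor C D (s : seq T) : uniq s -> {subset s <= vertices D} ->
  minor C D -> exists D', [/\ minor C D', vertices D' = vertices D :\: [set:: s] &
    forall S, spans D' S = spans D (S :\: [set:: s])].
Proof.
elim: s D => [|v s IH] D /=.
  by exists D; rewrite setD0; split=> // S; rewrite setD0.
move=> /andP[vs us] sD mD.
have sD' : {subset s <= vertices (deletion D v)}.
  move=> u us'; rewrite !inE (sD u) ?inE ?us' ?orbT // andbT.
  by apply: contraNneq vs => <-.
have vD : v \in vertices D by rewrite sD ?inE ?eqxx.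
have [D' [mD' VD' sp]] := IH _ us sD' (minor_del mD vD).
exists D'; split=> //; first by rewrite VD' /= set_cons setDDl.
by move=> S; rewrite sp spans_deletion setDDl set_cons setUC.
Qed.

Lemma contractions_minor C D (s : seq T) : uniq s -> {subset s <= vertices D} ->
  minor C D -> exists D', [/\ minor C D', vertices D' = vertices D :\: [set:: s] &
    forall S, spans D' S = spans D (S :|: [set:: s])].
Proof.
elim: s D => [|v s IH] D /=.
  by exists D; rewrite setD0; split=> // S; rewrite setU0.
move=> /andP[vs us] sD mD.
have sD' : {subset s <= vertices (contraction D v)}.
  move=> u us'; rewrite !inE (sD u) ?inE ?us' ?orbT // andbT.
  by apply: contraNneq vs => <-.
have vD : v \in vertices D by rewrite sD ?inE ?eqxx.
have [D' [mD' VD' sp]] := IH _ us sD' (minor_contr mD vD).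
exists D'; split=> //; first by rewrite VD' /= set_cons setDDl.
by move=> S; rewrite sp spans_contraction set_cons setUCA.
Qed.

(** Contract [I], then delete every remaining vertex outside [K]. *)
Lemma minor_spans C K I : K \subset vertices C -> I \subset vertices C ->
    [disjoint K & I] ->
  exists D, [/\ minor C D, vertices D = K &
    forall S, S \subset K -> spans D S = spans C (S :|: I)].
Proof.
move=> KV IV dKI.
have [|D1 [m1 V1 s1]] := contractions_minor (enum_uniq I) _ (minor_refl C).
  by move=> v; rewrite mem_enum; apply/subsetP.
have J1 : {subset enum (vertices C :\: I :\: K) <= vertices D1}.
  by move=> v; rewrite mem_enum V1 set_enum inE => /andP[_].
have [D2 [m2 V2 s2]] := deletions_minor (enum_uniq _) J1 m1.
exists D2; split=> //.
  rewrite V2 V1 !set_enum; apply/setP => v; rewrite !inE.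
  have [vK|vK] /= := boolP (v \in K); last by case: (v \in I); case: (v \in _).
  by rewrite (disjointFr dKI vK) (subsetP KV).
move=> S SK; rewrite s2 s1 !set_enum; congr (spans _ (_ :|: _)).
apply/setDidPl; rewrite -setI_eq0; apply/eqP/setP => v; rewrite !inE.
by apply/negP => /and3P[/(subsetP SK) -> ].
Qed.

(** * Proper minors of a minimally nonideal clutter *)

Lemma minimally_nonideal_cover C K I x w :
    minimally_nonideal R C -> K \proper vertices C -> I \subset vertices C ->
    [disjoint K & I] ->
    (forall v, v \in K -> 0 <= x v) ->
    (forall S, S \subset K -> spans C (S :|: I) -> 1 <= \sum_(v in S) x v) ->
    (forall v, v \in K -> 0 < w v) ->
  exists B, [/\ B \subset K, ~~ spans C ((K :\: B) :|: I) &
    \sum_(v in B) w v <= \sum_(v in K) w v * x v].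
Proof.
move=> [_ mni] pK IV dKI x0 xS w0.
have [D [mD VD sD]] := minor_spans (proper_sub pK) IV dKI.
(* The minor has the smaller vertex set [K], so it is proper and hence ideal. That [B] is a
   transversal of it means that the rest of [K] spans nothing. *)
have idD : ideal R D.
  by apply: mni => // DC; move: pK; rewrite -VD DC properxx.
have [|e eE||B [BV Bhit wB]] := @ideal_transversal D x w idD; rewrite ?VD //.
   have eK : e \subset K by rewrite -VD hyperedge_sub.
  by apply: xS => //; rewrite -sD //; apply/exists_inP; exists e.
rewrite VD in BV wB; exists B; split=> //; rewrite -sD ?subsetDl //.
apply/exists_inP => -[e eE]; rewrite subsetD => /andP[_].
by apply/negP/Bhit.
Qed.

(** The minor on [c |: S] is a degenerate projective plane. With [r = #|S|], its fractional cover
    [x] costs [r - 1 + 1/r], whereas every transversal costs at least [r]. *)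
Lemma no_delta_minor C I c (S : {set T}) :
    minimally_nonideal R C -> c |: S \proper vertices C -> I \subset vertices C ->
    [disjoint c |: S & I] -> c \notin S -> (1 < #|S|)%N ->
    {in S, forall i, spans C (c |: (i |: I))} -> spans C (S :|: I) ->
    ~~ spans C (c |: I) -> {in S, forall i, ~~ spans C (S :\ i :|: I)} ->
  False.
Proof.
move=> mni pK IV dKI cS r1 sp_ci sp_S nsp_c nsp_S.
set r : R := #|S|%:R; have {}r1 : 2 <= r by rewrite ler_nat.
have rV : r * r^-1 = 1 by rewrite divff // gt_eqF //; lra.
have rV0 : 0 < r^-1 by rewrite invr_gt0; lra.
(* [x] is the fractional vertex of the degenerate projective plane, exposed by [w]. *)
pose x v := if v == c then 1 - r^-1 else r^-1.
pose w v := if v == c then r - 1 else 1.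
have x0 v : 0 <= x v by rewrite /x; case: ifP => _; nra.
have w0 v : 0 < w v by rewrite /w; case: ifP => _; lra.
have xc : x c = 1 - r^-1 by rewrite /x eqxx.
have wc : w c = r - 1 by rewrite /w eqxx.
have neq_c i : i \in S -> (i == c) = false by move=> iS; apply: contraNF cS => /eqP <-.
have sumx : \sum_(v in S) x v = 1.
  rewrite (eq_bigr (fun=> r^-1)) => [|v vS]; last by rewrite /x neq_c.
  by rewrite sumr_const -[LHS]mulr_natl.
have sumw : \sum_(v in S) w v = r.
  by rewrite (eq_bigr (fun=> 1)) ?sumr_const // => v vS; rewrite /w neq_c.
have sub (f : T -> R) (A B : {set T}) : (forall v, 0 <= f v) -> A \subset B ->
    \sum_(v in A) f v <= \sum_(v in B) f v.
  move=> f0 AB; rewrite big_mkcond [leRHS]big_mkcond; apply: ler_sum => v _.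
  by have [/(subsetP AB) ->|_] := boolP (v \in A); last case: ifP.
have pair (f : T -> R) i : i \in S -> \sum_(v in [set c; i]) f v = f c + f i.
  by move=> iS; rewrite big_setU1 ?big_set1 // inE eq_sym neq_c.
have [//|||B [BK nspB]] := minimally_nonideal_cover (x := x) (w := w) mni pK IV dKI.
(* A spanning set contains [c] and some [i] of [S], or else all of [S]; both have [x]-sum 1. *)
- move=> A AK spA; have [cA|cA] := boolP (c \in A).
    have [i iA iS] : exists2 i, i \in A & i \in S.
      apply/exists_inP; apply: contraNT nsp_c => /exists_inPn noi.
      apply: spansS spA; apply/setSU/subsetP => v vA.
      by have := subsetP AK v vA; rewrite !inE (negPf (noi v vA)) orbF.
    apply: le_trans (sub x [set c; i] A x0 _); last first.
      by apply/subsetP => v; rewrite !inE => /orP[] /eqP ->.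
    by rewrite pair // xc /x neq_c // subrK.
  have AS : A \subset S.
    apply/subsetP => v vA; have := subsetP AK v vA; rewrite !inE.
    by case: eqP => // vc; rewrite vc (negPf cA) in vA.
  rewrite -sumx; apply: sub => //; apply/subsetP => i iS.
  apply: contraTT spA => iA; apply: contra (nsp_S i iS); apply: spansS.
  by apply: setSU; rewrite subsetD1 AS.
- by [].
apply/negP; rewrite -ltNge big_setU1 //= wc xc.
rewrite (eq_bigr x) => [|v vS]; last by rewrite /w neq_c // mul1r.
rewrite sumx; apply: (@lt_le_trans _ _ r); first by nra.
(* If [B] contains [c], it must also meet [S], since [S] spans; if it misses [c], it must contain
   all of [S] because of the pairs [{c, i}]. Either way it weighs at least [r]. *)
have [cB|cB] := boolP (c \in B).
  have [i iB iS] : exists2 i, i \in B & i \in S.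
    apply/exists_inP; apply: contraNT nspB => /exists_inPn noi.
    apply: spansS sp_S; apply/setSU/subsetP => v vS.
    by rewrite !inE vS orbT andbT; apply: contraTN vS => /noi.
  apply: le_trans (sub w [set c; i] B _ _) => [|v|].
  - by rewrite pair // wc /w neq_c // subrK.
  - exact/ltW.
  - by apply/subsetP => v; rewrite !inE => /orP[] /eqP ->.
rewrite -sumw; apply: sub => [v|]; first exact/ltW.
apply/subsetP => i iS; apply: contraNT nspB => iB; apply: spansS (sp_ci i iS).
rewrite setUA; apply/setSU/subsetP => v; rewrite !inE.
by case/orP => /eqP ->; rewrite ?eqxx ?cB ?iB ?iS ?orbT.
Qed.

End Ideal.

(** * The Singer model of PG(2,3) *)

(* PG(2,3) as the integers modulo 13, with the perfect difference set {0, 1, 3, 9}. *)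
Definition singer_line (k : nat) : seq nat :=
  [seq ((k + d) %% 13)%N | d <- [:: 0; 1; 3; 9]%N].

(* Coordinates of the powers of a root a of X^3 - X + 1 over F_3: as a^3 = a - 1 and
   a^9 = a^3 - 1, the points a^0, a^1, a^3, a^9 are collinear. *)
Definition singer_coords (i : nat) : seq nat :=
  iter i (fun u : seq nat =>
    [:: (2 * nth 0 u 2) %% 3; (nth 0 u 0 + nth 0 u 2) %% 3; nth 0 u 1]%N)
    [:: 1; 0; 0]%N.

Definition singer_dot (i j : nat) : nat :=
  let u := singer_coords i in let v := singer_coords j in
  (nth 0 u 0 * nth 0 v 0 + (nth 0 u 1 * nth 0 v 1 + nth 0 u 2 * nth 0 v 2))%N.

Definition singer_vec (i : nat) : 'rV['F_3]_3 :=
  \row_j (nth 0%N (singer_coords i) j)%:R.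

Definition singer_point (i : nat) : 'M['F_3]_3 := <<singer_vec i>>%MS.

Lemma natrF3_eq0 n : (n%:R == 0 :> 'F_3) = (n %% 3 == 0)%N.
Proof. by rewrite -(dvdn_pcharf (pchar_Fp _)). Qed.

(** The Singer vectors also serve as dual coordinates: a line is the plane orthogonal to one of
    them, and incidence becomes arithmetic modulo 3 that can be evaluated. *)
Lemma singer_dotE i j :
  (singer_vec i <= kermx (singer_vec j)^T)%MS = (singer_dot i j %% 3 == 0)%N.
Proof.
rewrite sub_kermx -natrF3_eq0; set d := _%:R.
have -> : singer_vec i *m (singer_vec j)^T = d%:M.
  apply/rowP => k; rewrite (ord1 k) mxE !big_ord_recl big_ord0 !mxE /= mulr1n addr0.
  by rewrite -!natrM -!natrD.
by rewrite -scalemx1 scaler_eq0 oner_eq0 orbF.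
Qed.

Lemma singer_vec_neq0 i : (i < 13)%N -> singer_vec i != 0.
Proof.
move=> lti; apply/eqP => /rowP v0.
have : all (fun i => has (fun j => nth 0 (singer_coords i) j %% 3 != 0)%N (iota 0 3))
  (iota 0 13) by vm_compute.
move=> /allP/(_ i); rewrite mem_iota => /(_ lti) /hasP[j].
rewrite mem_iota => /= ltj; have := v0 (Ordinal ltj).
by rewrite !mxE /= => /eqP; rewrite natrF3_eq0 => ->.
Qed.

(** All 26 nonzero vectors are checked by evaluation; the multipliers 1 and 2 are the nonzero
    scalars. *)
Lemma singer_vec_proportional (u : 'rV['F_3]_3) : u != 0 ->
  exists i a, [/\ (i < 13)%N, a != 0 & u = a *: singer_vec i].
Proof.
move=> u0.
have chk : all (fun a => all (fun b => all (fun c => ([:: a; b; c] != [:: 0; 0; 0])%N ==>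
   has (fun i => has (fun m => all (fun j =>
     nth 0 [:: a; b; c] j == (m * nth 0 (singer_coords i) j) %% 3)%N (iota 0 3)) [:: 1; 2]%N)
   (iota 0 13)) (iota 0 3)) (iota 0 3)) (iota 0 3) by vm_compute.
pose n j := u 0 j : nat.
have n3 j : n j \in iota 0 3 by rewrite mem_iota; apply: (ltn_ord (u 0 j)).
have uE j : u 0 j = (n j)%:R by rewrite [RHS]natr_Zp.
pose j0 : 'I_3 := 0; pose j1 : 'I_3 := 1; pose j2 : 'I_3 := 2%:R.
have nE (j : 'I_3) : nth 0%N [:: n j0; n j1; n j2] j = n j.
  by case: j => [[|[|[|//]]] ltj]; congr (n _); apply: val_inj.
move/allP: chk => /(_ _ (n3 j0)) /allP/(_ _ (n3 j1)) /allP/(_ _ (n3 j2)) /implyP chk.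
have /chk/hasP[i i13 /hasP[m m12 /allP{}chk]] :
    [:: n j0; n j1; n j2] != [:: 0; 0; 0]%N.
  apply: contraNneq u0 => n0; apply/eqP/rowP => j.
  by rewrite uE -nE n0 mxE; case: j => [[|[|[|]]]].
exists i, m%:R; split; first by rewrite mem_iota in i13.
  by rewrite natrF3_eq0; move: m12; rewrite !inE => /orP[] /eqP ->.
apply/rowP => j; have := chk j; rewrite mem_iota => /(_ (ltn_ord j)) /eqP.
by rewrite nE uE !mxE -natrM => ->; rewrite Fp_nat_mod.
Qed.

Lemma singer_point_pg i : (i < 13)%N -> singer_point i \in pg_points 'F_3.
Proof.
move=> lti; rewrite inE /singer_point genmx_id eqxx mxrank_gen rank_rV.
by rewrite singer_vec_neq0.
Qed.

Lemma pg_points_singer P : P \in pg_points 'F_3 ->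
  exists2 i, (i < 13)%N & P = singer_point i.
Proof.
rewrite inE => /andP[/eqP PE /eqP rP].
have u0 : nz_row P != 0 by rewrite nz_row_eq0 -mxrank_eq0 rP.
have [i [a [lti a0 uE]]] := singer_vec_proportional u0.
exists i => //; rewrite -PE; apply/genmxP.
have uP : (nz_row P == P)%MS.
  by rewrite -(geq_leqif (mxrank_leqif_eq (nz_row_sub P))) rP rank_rV u0.
have /eqmxP/eqmx_sym := uP; rewrite uE => e.
by apply/eqmxP/(eqmx_trans e)/eqmx_scale.
Qed.

(** For distinct [i] and [j], some line contains the first point but not the second. *)
Lemma singer_point_inj : {in gtn 13 &, injective singer_point}.
Proof.
move=> i j lti ltj /genmxP/andP[_ ji]; apply/eqP/contraT => nij.
have : all (fun i => all (fun j => (i != j) ==>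
   has (fun k => (singer_dot i k %% 3 == 0)%N && (singer_dot j k %% 3 != 0)%N) (iota 0 13))
   (iota 0 13)) (iota 0 13) by vm_compute.
move=> /allP/(_ i); rewrite mem_iota => /(_ lti) /allP/(_ j).
rewrite mem_iota => /(_ ltj); rewrite nij => /hasP[k _ /andP[]].
rewrite -!singer_dotE => ik /negP[]; exact: submx_trans ik.
Qed.

Lemma singer_line_pg k : (k < 13)%N ->
  [set:: map singer_point (singer_line k)] \in pg_lines 'F_3.
Proof.
move=> ltk.
have : all (fun k => has (fun m => all (fun i =>
   (i \in singer_line k) == (singer_dot i m %% 3 == 0)%N) (iota 0 13)) (iota 0 13))
   (iota 0 13) by vm_compute.
(* [m] gives the dual coordinates of the line [k]. *)
move=> /allP/(_ k); rewrite mem_iota => /(_ ltk) /hasP[m].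
rewrite mem_iota => ltm /allP kE; apply/imsetP.
exists (kermx (singer_vec m)^T).
  by rewrite inE mxrank_ker mxrank_tr rank_rV singer_vec_neq0.
apply/setP => P; rewrite in_set [RHS]in_set; apply/mapP/andP => [[i ik ->]|].
  have lti : (i < 13)%N by move: ik => /mapP[d _ ->]; rewrite ltn_pmod.
  split; first exact: singer_point_pg.
  rewrite genmxE singer_dotE; have := kE i; rewrite mem_iota => /(_ lti).
  by rewrite ik => /eqP <-.
move=> [/pg_points_singer[i lti ->]].
rewrite genmxE singer_dotE => im; exists i => //.
by have := kE i; rewrite mem_iota => /(_ lti)/eqP ->.
Qed.

(** * Exhaustive search over short lists of points *)

Fixpoint all_seqs (n : nat) (P : pred (seq nat)) : bool :=
  P [::] && if n is m.+1 then
    all (fun a => all_seqs m (fun s => P (a :: s))) (iota 0 13) else true.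

Lemma all_seqsP n P s : all_seqs n P -> (size s <= n)%N -> all (gtn 13) s -> P s.
Proof.
elim: s n P => [|a s IH] [|n] P => [/andP[]|/andP[]||/andP[_ /allP Pn] sn] //.
move=> /andP[a13 s13].
by apply: (IH n (fun s => P (a :: s))) => //; apply: Pn; rewrite mem_iota.
Qed.

(* A point other than [k] is on three of the nine lines that miss [k], so three
   points meeting these nine lines meet each of them once and are collinear with [k]. *)
Lemma small_cover k (s : seq nat) : (k < 13)%N -> (size s <= 3)%N ->
    all (gtn 13) s -> k \notin s ->
    (forall l, (l < 13)%N -> k \notin singer_line l -> has (mem s) (singer_line l)) ->
  all (mem (singer_line k)) s \/ size s = 3%N /\ ~~ has (mem (singer_line k)) s.
Proof.
move=> ltk s3 s13 ks cov.
have chk : all (fun k => all_seqs 3 (fun s =>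
    (k \notin s) ==>
    all (fun l => (k \in singer_line l) || has (mem s) (singer_line l)) (iota 0 13) ==>
    all (mem (singer_line k)) s || (size s == 3%N) && ~~ has (mem (singer_line k)) s))
  (iota 0 13) by vm_compute.
move/allP: chk => /(_ k); rewrite mem_iota => /(_ ltk) /all_seqsP/(_ s3 s13).
rewrite ks implyTb => /implyP chk.
have /chk/orP[] : all (fun l => (k \in singer_line l) || has (mem s) (singer_line l))
    (iota 0 13).
- apply/allP => l; rewrite mem_iota => ltl.
  by case: (boolP (k \in _)) => //= kl; apply: cov.
- by left.
- by case/andP=> /eqP; right.
Qed.

(** * Checkable certificates for the case distinction *)

Inductive refutation : Type :=
| Delta of seq nat & nat & seq nat
| Case of seq nat & refutation & refutation.

(* [pos] and [neg] list sets of points that contain, resp. do not contain, a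
   hyperedge. In [Delta p c r] contracting [p] and keeping [c :: r] gives the
   degenerate projective plane with centre [c]. *)
Fixpoint refutes (pos neg : seq (seq nat)) (t : refutation) : bool :=
  let spanning s := has (all (mem s)) pos in
  let nonspanning s := has (fun u => all (mem u) s) neg in
  match t with
  | Delta p c r => [&& all (gtn 13) (c :: r ++ p), uniq (c :: r ++ p),
      (1 < size r < 12)%N, all (fun i => spanning (c :: i :: p)) r,
      spanning (r ++ p), nonspanning (c :: p)
      & all (fun i => nonspanning (rem i r ++ p)) r]
  | Case s t u => refutes (s :: pos) neg t && refutes pos (s :: neg) u
  end.

(* Found by computer search; every set split on is a 6- or 7-point blocking set. *)
Definition blocking_refutation : refutation := (
  (Case [:: 0; 1; 5; 6; 9; 10]
   (Case [:: 1; 2; 5; 6; 9; 10]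
    (Case [:: 0; 1; 2; 6; 9; 10]
     (Delta [:: 1; 6; 9; 10] 0 [:: 2; 5])
     (Case [:: 0; 1; 2; 6; 8; 9; 10]
      (Delta [:: 1; 6; 9; 10] 5 [:: 0; 2; 8])
      (Case [:: 0; 1; 2; 6; 9; 10; 12]
       (Delta [:: 1; 6; 9; 10] 5 [:: 0; 2; 12])
       (Delta [:: 1; 6; 9; 10] 5 [:: 0; 2; 8; 12]))))
    (Case [:: 0; 1; 2; 6; 9; 10]
     (Case [:: 1; 2; 3; 5; 6; 9; 10]
      (Delta [:: 1; 6; 9; 10] 0 [:: 2; 3; 5])
      (Case [:: 1; 2; 5; 6; 9; 10; 11]
       (Delta [:: 1; 6; 9; 10] 0 [:: 2; 5; 11])
       (Delta [:: 1; 6; 9; 10] 0 [:: 2; 3; 5; 11])))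
     (Case [:: 1; 2; 5; 6; 9; 10; 11]
      (Delta [:: 1; 2; 6; 9; 10] 5 [:: 0; 11])
      (Case [:: 1; 2; 3; 5; 6; 9; 10]
       (Delta [:: 1; 2; 6; 9; 10] 5 [:: 0; 3])
       (Delta [:: 1; 2; 6; 9; 10] 0 [:: 3; 5; 11])))))
   (Case [:: 0; 1; 4; 5; 8; 9; 10]
    (Case [:: 0; 1; 4; 5; 9; 10; 11]
     (Case [:: 0; 1; 4; 5; 9; 10]
      (Case [:: 0; 1; 4; 5; 6; 10]
       (Case [:: 0; 1; 5; 6; 7; 9; 10]
        (Delta [:: 0; 1; 5; 10] 4 [:: 6; 7; 9])
        (Case [:: 0; 1; 2; 5; 6; 9; 10]
         (Delta [:: 0; 1; 5; 10] 4 [:: 2; 6; 9])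
         (Delta [:: 0; 1; 5; 10] 4 [:: 2; 6; 7; 9])))
       (Case [:: 0; 1; 3; 4; 5; 6; 10]
        (Delta [:: 0; 1; 5; 6; 10] 4 [:: 3; 9])
        (Case [:: 0; 1; 4; 5; 6; 10; 12]
         (Delta [:: 0; 1; 5; 6; 10] 4 [:: 9; 12])
         (Delta [:: 0; 1; 5; 6; 10] 9 [:: 3; 4; 12]))))
      (Case [:: 0; 1; 4; 5; 8; 9]
       (Case [:: 1; 4; 5; 8; 9; 10]
        (Delta [:: 1; 4; 5; 9] 8 [:: 0; 10; 11])
        (Delta [:: 1; 4; 5; 9; 10] 0 [:: 8; 11]))
       (Delta [:: 0; 1; 4; 5; 9] 10 [:: 8; 11])))
     (Case [:: 0; 1; 4; 5; 6; 9; 10]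
      (Delta [:: 0; 1; 5; 9; 10] 4 [:: 6; 8])
      (Case [:: 0; 1; 4; 5; 8; 9]
       (Case [:: 1; 4; 5; 8; 9; 10]
        (Delta [:: 1; 4; 5; 9] 8 [:: 0; 6; 10; 11])
        (Delta [:: 1; 4; 5; 9; 10] 8 [:: 0; 6; 11]))
       (Delta [:: 0; 1; 4; 5; 9] 8 [:: 6; 10; 11]))))
    (Case [:: 0; 1; 4; 5; 6; 9; 10]
     (Case [:: 0; 1; 4; 5; 9; 10; 11]
      (Delta [:: 0; 1; 5; 9; 10] 4 [:: 6; 11])
      (Delta [:: 0; 1; 5; 9; 10] 6 [:: 4; 8; 11]))
     (Case [:: 0; 1; 4; 5; 9; 10; 11]
      (Case [:: 0; 4; 5; 9; 10; 11]
       (Case [:: 0; 1; 4; 9; 10; 11]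
        (Delta [:: 0; 4; 9; 10] 11 [:: 1; 5; 6; 8])
        (Delta [:: 0; 1; 4; 9; 10] 11 [:: 5; 6; 8]))
       (Delta [:: 0; 4; 5; 9; 10] 11 [:: 1; 6; 8]))
      (Delta [:: 0; 1; 4; 5; 9; 10] 8 [:: 6; 11]))))))%N.

(** * Clutters whose minimum hyperedges are the lines of the plane *)

Section Plane.
Variables (R : realType) (T : finType) (C : clutter T) (h : nat -> T).
Let img (s : seq nat) : {set T} := [set:: map h s].

Hypothesis mni : minimally_nonideal R C.
Hypothesis h_inj : {in gtn 13 &, injective h}.
Hypothesis verticesE : vertices C = img (iota 0 13).
Hypothesis lineE : forall k, (k < 13)%N -> img (singer_line k) \in hyperedges C.
Hypothesis edge_ge4 : forall e, e \in hyperedges C -> (4 <= #|e|)%N.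

Let mem_img i s : (i < 13)%N -> all (gtn 13) s -> (h i \in img s) = (i \in s).
Proof.
move=> lti /allP s13; rewrite inE; apply/mapP/idP => [[j js /h_inj ->]|] //.
  by apply/s13.
by exists i.
Qed.

Let img_cat s t : img (s ++ t) = img s :|: img t.
Proof. by apply/setP => v; rewrite !inE map_cat mem_cat. Qed.

Let img_cons a s : img (a :: s) = h a |: img s.
Proof. by rewrite /img map_cons set_cons. Qed.

Let img_vertices s : all (gtn 13) s -> img s \subset vertices C.
Proof.
move=> /allP s13; apply/subsetP => v; rewrite inE => /mapP[i /s13 lti ->].
by rewrite verticesE mem_img ?mem_iota //; apply/allP => j; rewrite mem_iota.
Qed.

Let card_img s : uniq s -> all (gtn 13) s -> #|img s| = size s.
Proof.
move=> us /allP s13; rewrite cardsE; apply/eqP.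
rewrite -(size_map h s); apply/eqP/card_uniqP.
by rewrite map_inj_in_uniq // => i j /s13 + /s13; apply: h_inj.
Qed.

Let line13 k : all (gtn 13) (singer_line k).
Proof. by rewrite /= !ltn_mod. Qed.

Let line_uniq k : (k < 13)%N -> uniq (singer_line k).
Proof.
have : all (fun k => uniq (singer_line k)) (iota 0 13) by vm_compute.
by move=> /allP/(_ k); rewrite mem_iota; apply.
Qed.

Let imgP (B : {set T}) : B \subset vertices C -> exists s, [/\ uniq s, all (gtn 13) s & B = img s].
Proof.
move=> BV; exists [seq i <- iota 0 13 | h i \in B]; split.
- by rewrite filter_uniq ?iota_uniq.
- by apply/allP => i; rewrite mem_filter mem_iota => /andP[].
- apply/setP => v; rewrite inE; apply/idP/mapP => [vB|[i]].
    have := subsetP BV v vB; rewrite verticesE inE => /mapP[i i13 vE].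
    by exists i; rewrite // mem_filter i13 -vE vB.
  by rewrite mem_filter => /andP[hB _] ->.
Qed.

(* The deletion of [k] is ideal, so the constant vector 1/4 dominates a convex
   combination of its transversals, which must be the four lines through [k] minus
   [k]; the weights [w] single out the one labelled [k]. *)
Lemma hyperedge_meets_line k e : (k < 13)%N -> e \in hyperedges C ->
  ~~ [disjoint e & img (singer_line k)].
Proof.
move=> ltk eE; apply/negP => dis.
set M := img (singer_line k) in dis.
have kline : k \in singer_line k by rewrite inE addn0 modn_small ?eqxx.
have kM : h k \in M by rewrite mem_img.
have MV : M \subset vertices C by apply: img_vertices.
have cardM : #|M| = 4%N by rewrite card_img ?line_uniq.
have kV : h k \in vertices C by apply: (subsetP MV).
have cardV : #|vertices C| = 13%N.
  by rewrite verticesE card_img ?iota_uniq ?size_iota.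
have cardMk : #|M :\ h k| = 3%N by have := cardsD1 (h k) M; rewrite kM cardM => -[].
pose x : T -> R := fun=> 4^-1.
pose w v : R := 4 - (v \in M)%:R.
have sumw (A : {set T}) : \sum_(v in A) w v = 4 * #|A|%:R - #|A :&: M|%:R.
  rewrite /w sumrB sumr_const mulr_natr; congr (_ - _).
  rewrite -sum1_card natr_sum big_mkcond [RHS]big_mkcond.
  by apply: eq_bigr => v _; rewrite in_setI; case: (v \in A); case: (v \in M).
have w0 v : v \in vertices C :\ h k -> 0 < w v by rewrite /w; case: (v \in M) => _ /=; lra.
have xS (S : {set T}) : S \subset vertices C :\ h k -> spans C (S :|: set0) ->
    1 <= \sum_(v in S) x v.
  rewrite setU0 => _ /exists_inP[f /edge_ge4 f4 /subset_leq_card fS].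
  rewrite /x sumr_const -[leRHS]mulr_natl ler_pdivlMr ?mul1r ?ler_nat //.
  by rewrite (leq_trans f4).
have [|||//|B [BK nsp]] := minimally_nonideal_cover (x := x) mni _ _ _ _ xS w0.
- by rewrite properD1.
- exact: sub0set.
- by rewrite -setI_eq0 setI0.
- by move=> v _; rewrite invr_ge0 ler0n.
rewrite -mulr_suml !sumw.
have -> : (vertices C :\ h k) :&: M = M :\ h k.
  by rewrite setIDAC (setIidPr MV).
have -> : #|vertices C :\ h k| = 12%N.
  by have := cardsD1 (h k) (vertices C); rewrite kV cardV => -[].
rewrite cardMk => wB.
have [s [us s13 sE]] := imgP (subset_trans BK (subD1set _ _)).
have kB : h k \notin B by apply/negP => /(subsetP BK); rewrite !inE eqxx.
have BM3 : #|B :&: M|%:R <= 3%:R :> R.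
  rewrite ler_nat -cardMk subset_leq_card //.
  by rewrite subsetD1 subsetIr in_setI negb_and kB.
(* The total weight of the 12 remaining points is [4 * 12 - 3 = 45], so
   [4 * #|B| - #|B :&: M| <= 45/4]; since [B] has at most 3 points on [M], it has at most 3
   points. *)
have B4 : #|B|%:R < 4%:R :> R by lra.
rewrite ltr_nat in B4.
have [||||||] := @small_cover k s => //.
- by rewrite -(card_img us s13) -sE -ltnS.
- by rewrite -(mem_img ltk s13) -sE.
(* Lines that miss [k] survive its deletion, so [B] meets them. *)
- move=> l ltl kl; apply: contraNT nsp => nhas; rewrite setU0.
  apply/exists_inP; exists (img (singer_line l)); first exact: lineE.
  apply/subsetP => v; rewrite inE => /mapP[i il ->].
  have lti : (i < 13)%N by apply: (allP (line13 l)).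
  have neq : i != k by apply: contraNneq kl => <-.
  rewrite sE inE mem_img //.
  apply/andP; split; first by apply: contra nhas => si; apply/hasP; exists i.
  rewrite inE (subsetP (img_vertices (line13 l))) ?mem_img // andbT inE.
  by apply: contra neq => /eqP/h_inj ->.
(* If [B] lies on the line, then [e], being disjoint from the line, survives the deletion and avoids
   [B]. *)
- move=> sk; case/negP: nsp; rewrite setU0; apply/exists_inP; exists e => //.
  apply/subsetP => v ve; have vV := subsetP (hyperedge_sub eE) v ve.
  have vM := disjointFr dis ve.
  rewrite !inE vV andbT; apply/andP; split; last by apply: contraFneq vM => ->.
  apply: contraFN vM; rewrite sE in_set => /mapP[i si ->].
  by rewrite mem_img; [apply: (allP sk) | apply: (allP s13) | apply: line13].
(* Three points off the line weigh 12, which exceeds [45/4]. *)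
- case=> s3 nhas; move: wB; suff -> : B :&: M = set0.
    by rewrite cards0 sE card_img // s3; lra.
  apply/setP => v; rewrite in_setI in_set0; apply/negP => /andP[].
  rewrite sE in_set => /mapP[i si ->]; rewrite mem_img //; last exact: (allP s13).
  by move=> ik; case/hasP: nhas; exists i.
Qed.

(** A [Case] node is excluded middle on whether its set spans, and a [Delta] leaf verifies the
    hypotheses of [no_delta_minor], by monotonicity from the listed sets. *)
Lemma refutes_sound pos neg t : refutes pos neg t ->
  {in pos, forall s, spans C (img s)} -> {in neg, forall s, ~~ spans C (img s)} ->
  False.
Proof.
have mono s u : all (mem u) s -> spans C (img s) -> spans C (img u).
  move=> /allP su; apply: spansS; apply/subsetP => v.
  by rewrite !inE => /mapP[i /su iu ->]; apply: map_f.
elim: t pos neg => [I c S|s t IHt u IHu] pos neg /=; last first.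
  case/andP=> ct cu posok negok; have [sp|nsp] := boolP (spans C (img s)).
    by apply: IHt ct _ negok => r; rewrite inE => /predU1P[->|/posok].
  by apply: IHu cu posok _ => r; rewrite inE => /predU1P[->|/negok].
case/and4P=> /andP[c13]; rewrite all_cat => /andP[S13 I13] /andP[].
rewrite mem_cat negb_or cat_uniq => /andP[cS cI] /and3P[uS dSI uI] /andP[S1 S12].
case/and4P=> spc spS nspc nspS posok negok.
have yes r : has (all (mem r)) pos -> spans C (img r).
  by case/hasP=> p /posok sp /mono; apply.
have no r : has (fun u => all (mem u) r) neg -> ~~ spans C (img r).
  by case/hasP=> p /negok nsp /mono rp; apply: contra nsp.
have cardS := card_img uS S13.
apply: (@no_delta_minor R T C (img I) (h c) (img S) mni).
(* The check [size r < 12] leaves at least one of the 13 points outside the minor, which is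
   therefore proper. *)
- rewrite -img_cons properEcard img_vertices /= ?c13 //.
  by rewrite verticesE !card_img ?iota_uniq //= ?size_iota ?cS ?c13.
- exact: img_vertices.
- rewrite -img_cons; apply/pred0P => v /=; apply/negP.
  case/andP; rewrite !in_set => /mapP[i ci ->] /mapP[j jI /h_inj].
  have i13 : (i < 13)%N by move: ci; rewrite inE => /predU1P[->|/(allP S13)].
  move=> /(_ i13 (allP I13 j jI)) ij; move: ci; rewrite ij inE => /predU1P[jc|jS].
    by rewrite -jc jI in cI.
  by case/hasP: dSI; exists j.
- by rewrite mem_img.
- by rewrite cardS.
- move=> v; rewrite inE => /mapP[i iS ->].
  by rewrite -!img_cons; apply/yes/(allP spc).
- by rewrite -img_cat; apply: yes.
- by rewrite -img_cons; apply: no.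
- move=> v; rewrite inE => /mapP[i iS ->].
  have -> : img S :\ h i = img (rem i S).
    apply/setP => v'; rewrite !inE; apply/andP/mapP => [[neq /mapP[j jS vE]]|[j]].
      exists j => //; rewrite mem_rem_uniq // inE jS andbT.
      by apply: contraNneq neq => <-; rewrite vE.
    rewrite mem_rem_uniq // inE => /andP[neq jS] ->; rewrite map_f //; split=> //.
    by apply: contra neq => /eqP/h_inj ->; rewrite // ?inE; apply: (allP S13).
  by rewrite -img_cat; apply/no/(allP nspS).
Qed.

Lemma no_singer_core : False.
Proof.
pose lines := map singer_line (iota 0 13).
(* The complement of a line spans nothing, because every hyperedge meets every line. *)
pose colines := [seq [seq i <- iota 0 13 | i \notin s] | s <- lines].
apply: (@refutes_sound lines colines blocking_refutation); first by vm_compute.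
  move=> s /mapP[k]; rewrite mem_iota => ltk ->.
  by apply/exists_inP; exists (img (singer_line k)); rewrite ?lineE.
move=> s /mapP[l /mapP[k]]; rewrite mem_iota => ltk -> ->.
apply/exists_inP => -[e eE /subsetP es]; case/negP: (hyperedge_meets_line ltk eE).
apply/pred0P => v /=; apply/negP => /andP[/es]; rewrite inE => /mapP[i].
rewrite mem_filter mem_iota => /andP[ik lti] ->.
by rewrite mem_img // (negPf ik).
Qed.

End Plane.

(** * Transfer from the given labelling to the Singer model *)

Theorem theorem6p5 (R : realType) :
  ~ exists (T : finType) (C : clutter T),
      minimally_nonideal R C /\ core_is_PG2 'F_3 C.
Proof.
move=> [T [C [mni [phi [phi_inj phiV phi_core]]]]].
have /imsetP[v0 _ _] : singer_point 0 \in phi @: vertices C.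
  by rewrite phiV singer_point_pg.
(* [h] inverts the labelling [phi]; the default [v0] is never returned for [i < 13]. *)
pose h i := odflt v0 [pick v in vertices C | phi v == singer_point i].
have hP i : (i < 13)%N -> h i \in vertices C /\ phi (h i) = singer_point i.
  move=> lti; rewrite /h; case: pickP => [v /andP[vV /eqP]|] //=.
  have := singer_point_pg lti; rewrite -phiV => /imsetP[v vV vE].
  by move/(_ v); rewrite vV vE eqxx.
have line_edge k : (k < 13)%N -> [set:: map h (singer_line k)] \in core C.
  move=> ltk; have := singer_line_pg ltk; rewrite -phi_core => /imsetP[e ec eE].
  suff -> : [set:: map h (singer_line k)] = e by [].
  have eV : e \subset vertices C.
    by apply: hyperedge_sub; move: ec; rewrite inE => /andP[].
  have l13 i : i \in singer_line k -> (i < 13)%N.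
    by case/mapP=> d _ ->; rewrite ltn_mod.
  apply/setP => v; rewrite in_set; apply/mapP/idP => [[i il ->]|ve].
    have [hV hE] := hP i (l13 i il).
    have : phi (h i) \in phi @: e by rewrite -eE hE in_set; apply: map_f.
    case/imsetP=> u ue /phi_inj -> //; exact: (subsetP eV).
  have : phi v \in phi @: e by apply: imset_f.
  rewrite -eE in_set => /mapP[i il vE]; exists i => //.
  have [hV hE] := hP i (l13 i il).
  by apply: phi_inj; rewrite ?vE //; apply: (subsetP eV).
have h_inj : {in gtn 13 &, injective h}.
  move=> i j lti ltj hij; apply: singer_point_inj => //.
  by rewrite -(hP i lti).2 hij (hP j ltj).2.
apply: (no_singer_core mni h_inj).
- apply/setP => v; rewrite in_set; apply/idP/mapP => [vV|[i]].
    have : phi v \in pg_points 'F_3 by rewrite -phiV imset_f.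
    case/pg_points_singer=> i lti vE; exists i; rewrite ?mem_iota //.
    by have [hV hE] := hP i lti; apply: phi_inj; rewrite ?vE.
  by rewrite mem_iota => lti ->; case: (hP i lti).
- by move=> k /line_edge; rewrite inE => /andP[].
- move=> e eE; have := line_edge 0%N isT; rewrite inE => /andP[_ /forall_inP/(_ e eE)].
  apply: leq_trans; apply: eq_leq; rewrite cardsE.
  suff /card_uniqP -> : uniq (map h (singer_line 0)) by [].
  rewrite map_inj_in_uniq // => i j /(allP (isT : all (gtn 13) (singer_line 0))) lti.
  by move/(allP (isT : all (gtn 13) (singer_line 0))); apply: h_inj.
Qed.
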